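(* Let $(X,d_X)$ be a nonempty semimetric space. If not all weak similarities $\Phi:X\to X$ are isometries, then there are sets $A_1,A_2,A_3\subseteq D(X)$ with $A_2\neq\varnothing$ such that $$\mathrm{tp}(D(X))=\mathrm{tp}(A_1)+\mathrm{tp}(A_2)\,\mathrm{tp}(\mathbb Z)+\mathrm{tp}(A_3).$$
   Context: A semimetric on a set $X$ is a function $d:X\times X\to[0,\infty)$ with $d(x,y)=d(y,x)$ and $(d(x,y)=0\Leftrightarrow x=y)$ for all $x,y\in X$; $(X,d)$ is then a semimetric space. The distance set of a nonempty semimetric space is $D(X)=\{d(x,y):x,y\in X\}$. A surjective mapping $\Phi:X\to Y$ between nonempty semimetric spaces is a weak similarity if there is a strictly increasing function $f:D(Y)\to D(X)$ such that $d_X(x,y)=f(d_Y(\Phi(x),\Phi(y)))$ for all $x,y\in X$. An isometry is a bijection between semimetric spaces preserving distances. Subsets of $[0,\infty)$ carry the standard order, and $\mathbb Z$ is the set of integers with the standard order. The order-type $\mathrm{tp}(P)$ of a poset $P$ is the class of all posets order-isomorphic to $P$ (via a bijection $f$ with $a\leqslant b\Leftrightarrow f(a)\leqslant f(b)$). For a poset $(I,\prec)$ and posets $(P_i,\leqslant_i)$, $i\in I$, with pairwise disjoint carrier sets, the ordered sum $\sum_{i\in I}(P_i,\leqslant_i)$ is the set $\bigcup_{i\in I}P_i$ ordered by: $a\leqslant b$ iff either $a,b$ lie in the same $P_i$ and $a\leqslant_i b$, or $a\in P_i$, $b\in P_j$ with $i\neq j$ and $i\prec j$. The sum $\tau_1+\dots+\tau_n$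 of order-types is the order-type of the ordered sum over $I=\{1,\dots,n\}$ (standard order) of pairwise disjoint posets $P_i$ with $\mathrm{tp}(P_i)=\tau_i$. The product $\tau\,\mathrm{tp}(I)$ is the order-type of the ordered sum over $I$ of pairwise disjoint posets $P_i$, $i\in I$, all of order-type $\tau$. (Thus $\mathrm{tp}(A_2)\,\mathrm{tp}(\mathbb Z)$ is the type of a $\mathbb Z$-indexed ordered sum of copies of $A_2$.) *)

(* Defs.v *)
From HB Require Import structures.
From mathcomp Require Export all_boot all_order all_algebra.
From mathcomp Require Export mathcomp_extra boolp classical_sets functions reals.

Set Implicit Arguments.
Unset Strict Implicit.
Unset Printing Implicit Defensive.

Import Order.TTheory GRing.Theory Num.Theory.

Local Open Scope classical_set_scope.
Local Open Scope ring_scope.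

Record semimetricSpace (R : realType) := SemimetricSpace {
  carrier :> Type;
  dist : carrier -> carrier -> R;
  dist_ge0 : forall x y, 0 <= dist x y;
  distC : forall x y, dist x y = dist y x;
  dist_eq0 : forall x y, dist x y = 0 <-> x = y }.

Definition distance_set (R : realType) (X : semimetricSpace R) : set R :=
  [set r | exists x y : X, r = dist x y].

(* [f] is a total function R -> R mapping D(Y) into D(X); its values outside
   D(Y) are irrelevant. *)
Definition weak_similarity (R : realType) (X Y : semimetricSpace R)
    (Phi : X -> Y) : Prop :=
  (forall y, exists x, Phi x = y) /\
  exists f : {fun distance_set Y >-> distance_set X},
    {in distance_set Y &, {homo f : a b / a < b}} /\
    forall x y, dist x y = f (dist (Phi x) (Phi y)).

Definition isometry (R : realType) (X Y : semimetricSpace R)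
    (Phi : X -> Y) : Prop :=
  bijective Phi /\ forall x y, dist (Phi x) (Phi y) = dist x y.

(* A set of elements of a poset, seen as a type, carries the induced order. *)
HB.instance Definition _ (T : choiceType) (A : set T) :=
  SubChoice.copy (set_type A) {x : T | x \in A}.
HB.instance Definition _ d (T : porderType d) (A : set T) :=
  [SubChoice_isSubPOrder of set_type A by <: with d].

(* Order-types are classes of posets. A class ranges over all displays because
   these are only a printing device. *)
Definition order_type := forall d : Order.disp_t, porderType d -> Prop.

Definition order_iso d d' (P : porderType d) (Q : porderType d') : Prop :=
  exists f : P -> Q, bijective f /\ forall a b, (a <= b)%O <-> (f a <= f b)%O.

Definition tp d (P : porderType d) : order_type := fun d' Q => order_iso P Q.

(* The disjoint union of the P i is {i : I & P i}; its default order in the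
   library (Order.SigmaOrder) compares tags first and then, for equal tags,
   elements of the common P i. *)
Definition ordered_sum d d' (I : porderType d) (P : I -> porderType d') :
  porderType d' := {i : I & P i}.

Definition ot_sum (n : nat) (tau : 'I_n -> order_type) : order_type :=
  fun d Q => exists (d' : Order.disp_t) (P : 'I_n -> porderType d'),
    (forall i, tp (P i) = tau i) /\ tp (ordered_sum P) Q.

Definition ot_mul (tau sigma : order_type) : order_type :=
  fun d Q => exists (d1 d2 : Order.disp_t) (I : porderType d1)
      (P : I -> porderType d2),
    [/\ tp I = sigma, forall i, tp (P i) = tau & tp (ordered_sum P) Q].

Definition ot_add3 (tau1 tau2 tau3 : order_type) : order_type :=
  ot_sum (fun i : 'I_3 =>
    match val i with 0%N => tau1 | 1%N => tau2 | _ => tau3 end).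

(* Main.v *)
From HB Require Import structures.
Require Import Defs.

(** Comparing [dist x y = f (dist (Phi x) (Phi y))] with the surjectivity of
    [Phi] shows that [f] is an order automorphism of D(X); it is not the
    identity when [Phi] is not an isometry. Passing to the inverse if needed, some [t]
    satisfies [t < f t], and the orbit of [t] under the powers of [f] cuts D(X)
    into the distances below the orbit, those above it, and the intervals
    [f^n t, f^(n+1) t), each of which is the image under [f^n] of the interval
    [t, f t). *)

Set Implicit Arguments.
Unset Strict Implicit.
Unset Printing Implicit Defensive.

Import Order.TTheory GRing.Theory Num.Theory.

(** Totality passes to subsets, so the trichotomy arguments below can be run inside D(X) seen as a
    type. *)
HB.instance Definition _ d (T : orderType d) (A : set T) :=
  [SubPOrder_isSubOrder of set_type A by <: with d].

Local Open Scope classical_set_scope.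

Definition to_set_type T (A : set T) (x : T) (Ax : A x) : set_type A :=
  exist (fun y => y \in A) x (mem_set Ax).

Lemma set_typeP T (A : set T) (x : set_type A) : A (val x).
Proof. exact/set_mem/valP. Qed.

(** * Order isomorphisms and equality of order-types *)

Section OrderIso.

Lemma order_embedding_inj d d' (P : porderType d) (Q : porderType d')
    (f : P -> Q) :
  (forall a b, (a <= b)%O <-> (f a <= f b)%O) -> injective f.
Proof.
by move=> fle a b fab; apply/le_anti/andP; split; apply/fle; rewrite fab.
Qed.

(** Antisymmetry makes an order embedding injective, so only surjectivity has to be checked. *)
Lemma surj_order_iso d d' (P : porderType d) (Q : porderType d') (f : P -> Q) :
  (forall b, exists a, f a = b) ->
  (forall a b, (a <= b)%O <-> (f a <= f b)%O) -> order_iso P Q.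
Proof.
move=> /choice[g fK] fle; exists f; split => //.
by exists g => // a; apply: (order_embedding_inj fle).
Qed.

Lemma order_iso_refl d (P : porderType d) : order_iso P P.
Proof. by apply: (@surj_order_iso _ _ _ _ id) => // b; exists b. Qed.

Lemma order_iso_sym d d' (P : porderType d) (Q : porderType d') :
  order_iso P Q -> order_iso Q P.
Proof.
move=> [f [[g fK gK] fle]]; apply: (@surj_order_iso _ _ _ _ g) => [b|a b].
  by exists (f b).
by rewrite fle !gK.
Qed.

Lemma order_iso_trans d d' d'' (P : porderType d) (Q : porderType d')
    (S : porderType d'') :
  order_iso P Q -> order_iso Q S -> order_iso P S.
Proof.
move=> [f [bf fle]] [g [bg gle]]; exists (g \o f); split; first exact: bij_comp.
by move=> a b; rewrite fle gle.
Qed.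

(** Order-types are predicates on posets, so functional and propositional extensionality turn
    isomorphism into an equality usable for rewriting. *)
Lemma eq_tpP d d' (P : porderType d) (Q : porderType d') :
  tp P = tp Q <-> order_iso P Q.
Proof.
split=> [PQ|PQ].
  have : tp Q Q by apply: order_iso_refl.
  by rewrite -PQ.
apply: functional_extensionality_dep => d''; apply/funext => S; apply/propext.
split; apply: order_iso_trans => //; exact: order_iso_sym.
Qed.

End OrderIso.

(** * Ordered sums, and sums and products of order-types *)

Section OrderedSum.

Lemma le_ordered_sum_same d d' (I : porderType d) (P : I -> porderType d') i
    (x y : P i) :
  ((Tagged P x : ordered_sum P) <= (Tagged P y : ordered_sum P))%O = (x <= y)%O.
Proof. by rewrite leEsig /= lexx tagged_asE. Qed.

Lemma le_ordered_sum_diff d d' (I : porderType d) (P : I -> porderType d') i j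
    (x : P i) (y : P j) : i != j ->
  ((Tagged P x : ordered_sum P) <= (Tagged P y : ordered_sum P))%O = (i < j)%O.
Proof.
move=> neq_ij; rewrite leEsig /= lt_neqAle neq_ij /=.
case: (comparableP i j) => //= eq_ij; by rewrite eq_ij eqxx in neq_ij.
Qed.

(** This is what makes [ot_add3] and [ot_mul] independent of the chosen representatives. *)
Lemma ordered_sum_iso d1 d2 d1' d2' (I : porderType d1) (J : porderType d2)
    (P : I -> porderType d1') (Q : J -> porderType d2') (h : I -> J) :
  bijective h -> (forall i j, (i <= j)%O <-> (h i <= h j)%O) ->
  (forall i, order_iso (P i) (Q (h i))) ->
  order_iso (ordered_sum P) (ordered_sum Q).
Proof.
move=> [h' hK h'K] hle PQ.
have {PQ} [k kP] : {k : forall i, P i -> Q (h i) | forall i, bijective (k i)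
    /\ forall a b, (a <= b)%O <-> (k i a <= k i b)%O}.
  exists (fun i => sval (cid (PQ i))) => i; exact: (svalP (cid (PQ i))).
pose F (u : ordered_sum P) : ordered_sum Q := Tagged Q (k (tag u) (tagged u)).
apply: (@surj_order_iso _ _ _ _ F) => [[j y]|[i x] [j y]].
  (* Rewriting [j] as [h (h' j)] puts [y] into the codomain of [k (h' j)], where the inverse of that
     map applies. *)
  case: _ / (h'K j) y => y; case: (kP (h' j)) => -[k' _ k'K] _.
  by exists (Tagged P (k' y)); rewrite /F /= k'K.
have hI := can_inj hK.
rewrite /F /=; have [eq_ij|neq_ij] := eqVneq i j.
  case: _ / eq_ij y => y.
  by rewrite !le_ordered_sum_same; apply: (kP i).2.
rewrite !le_ordered_sum_diff ?(inj_eq hI)//.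
by rewrite !lt_neqAle (inj_eq hI) neq_ij /= hle.
Qed.

(** Totality of [I] lets separation of the pieces also give the converse: indices in the wrong order
    would reverse the inequality strictly. *)
Lemma ordered_sum_decomposition d d' d'' (I : orderType d)
    (P : I -> porderType d') (Q : porderType d'') (g : forall i, P i -> Q) :
  (forall i a b, (a <= b)%O <-> (g i a <= g i b)%O) ->
  (forall i j a b, (i < j)%O -> (g i a < g j b)%O) ->
  (forall q, exists i a, g i a = q) -> order_iso (ordered_sum P) Q.
Proof.
move=> gle glt gsurj.
pose G (u : ordered_sum P) := g (tag u) (tagged u).
apply: (@surj_order_iso _ _ _ _ G).
  by move=> q; have [i [a <-]] := gsurj q; exists (Tagged P a).
move=> [i x] [j y]; rewrite /G /=; have [eq_ij|neq_ij] := eqVneq i j.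
  by case: _ / eq_ij y => y; rewrite le_ordered_sum_same.
rewrite le_ordered_sum_diff//; split => [/glt ltg|]; first exact/ltW/ltg.
move: neq_ij; rewrite neq_lt => /orP[//|/glt ltg].
by move=> /(lt_le_trans (ltg y x)); rewrite ltxx.
Qed.

Lemma ot_add3_tp d (P : 'I_3 -> porderType d) :
  ot_add3 (tp (P (inord 0))) (tp (P (inord 1))) (tp (P (inord 2))) =
  tp (ordered_sum P).
Proof.
have tpE (i : 'I_3) : match val i with
    | 0%N => tp (P (inord 0))
    | 1%N => tp (P (inord 1))
    | _ => tp (P (inord 2)) end = tp (P i).
  case: i => -[|[|[|//]]] lti3 /=;
    by congr (tp (P _)); apply: val_inj; rewrite /= inordK.
apply: functional_extensionality_dep => d'; apply/funext => Q; apply/propext.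
split=> [[d'' [P' [P'E]]]|PQ]; last by exists d, P; split.
apply: order_iso_trans; apply: (@ordered_sum_iso _ _ _ _ _ _ _ _ id) => //.
  by exists id.
by move=> i; apply: order_iso_sym; apply/eq_tpP; rewrite P'E tpE.
Qed.

Lemma ot_mul_tp d d' (A : porderType d) (I : porderType d') :
  ot_mul (tp A) (tp I) = tp (ordered_sum (fun _ : I => A)).
Proof.
apply: functional_extensionality_dep => d''; apply/funext => Q; apply/propext.
split=> [[d1 [d2 [J [P [/eq_tpP JI PA]]]]]|AQ].
  apply: order_iso_trans; have [h [hbij hle]] := order_iso_sym JI.
  apply: (ordered_sum_iso hbij hle) => i.
  by apply: order_iso_sym; apply/eq_tpP.
by exists d', d, I, (fun=> A); split.
Qed.

(** The pieces are first found as sets of elements of the type of D(X); this turns them into sets of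
    reals of the same order-type. *)
Lemma image_val_order_iso d (T : porderType d) (A : set T)
    (B : set (set_type A)) :
  order_iso (set_type B) (set_type (val @` B)).
Proof.
have BP (x : set_type B) : (val @` B) (val (val x)).
  by exists (val x) => //; exact: set_typeP.
apply: (@surj_order_iso _ _ _ _ (fun x => to_set_type (BP x))) => // y.
have [x Bx xy] := set_typeP y.
by exists (to_set_type Bx); apply: val_inj.
Qed.

End OrderedSum.

(** * Integer powers of a bijection *)

Section IntegerIterates.
Context (T : Type) (f g : T -> T).
Hypotheses (fK : cancel f g) (gK : cancel g f).

(** The power f^n, with [g] as the inverse of [f]. Since [Negz k] is -(k+1), it takes k+1 iterations
    of [g]. *)
Definition int_iter (n : int) : T -> T :=
  match n with Posz k => iter k f | Negz k => iter k.+1 g end.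

Local Open Scope ring_scope.

Lemma int_iterS n x : int_iter (n + 1) x = f (int_iter n x).
Proof.
(* The case n = -1 stands apart because adding 1 there crosses from [Negz] to [Posz]. *)
case: n => [k|[|k]]; first by rewrite addrC -intS.
- by rewrite /= gK.
- rewrite [int_iter (Negz _) x]/= gK.
  by rewrite NegzE intS opprD addrAC addNr add0r -NegzE.
Qed.

Lemma int_iterB1 n x : int_iter (n - 1) x = g (int_iter n x).
Proof. by rewrite -{2}(subrK 1 n) int_iterS fK. Qed.

Lemma int_iterD m n x : int_iter (m + n) x = int_iter m (int_iter n x).
Proof.
elim/int_ind: m x => [|m IH|m IH] x; first by rewrite add0r.
- by rewrite intS (addrC 1) int_iterS -IH -int_iterS addrAC.
- by rewrite intS opprD (addrC (-1)) int_iterB1 -IH -int_iterB1 addrAC.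
Qed.

Lemma int_iterK n : cancel (int_iter n) (int_iter (- n)).
Proof. by move=> x; rewrite -int_iterD addNr. Qed.

Lemma int_iterNK n : cancel (int_iter (- n)) (int_iter n).
Proof. by move=> x; rewrite -int_iterD addrN. Qed.

End IntegerIterates.

Lemma cancel_homo_lt d (P Q : orderType d) (f : P -> Q) (g : Q -> P) :
  cancel g f -> {homo f : x y / (x < y)%O} -> {homo g : x y / (x < y)%O}.
Proof.
move=> gK f_lt x y.
by rewrite -{1}(gK x) -{1}(gK y) (leW_mono (le_mono f_lt)).
Qed.

(** * The orbit of a moved point cuts a total order *)

Section Orbit.
Context d (P : orderType d) (f g : P -> P) (t : P).
Hypotheses (fK : cancel f g) (gK : cancel g f).
Hypotheses (f_lt : {homo f : x y / (x < y)%O}) (t_lt : (t < f t)%O).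

Local Notation F := (int_iter f g).
Local Open Scope ring_scope.

Lemma int_iter_lt n : {mono F n : x y / (x < y)%O}.
Proof.
have g_lt := cancel_homo_lt gK f_lt.
have F_lt m : {homo F m : x y / (x < y)%O}.
  move=> x y xy; elim/int_ind: m => [//|m IH|m IH].
    by rewrite intS addrC !int_iterS//; apply: f_lt.
  by rewrite intS opprD addrC !int_iterB1//; apply: g_lt.
by move=> x y; apply/idP/idP => [/(F_lt (- n))|/F_lt//]; rewrite !int_iterK.
Qed.

Lemma int_iter_le n : {mono F n : x y / (x <= y)%O}.
Proof. by move=> x y; rewrite !leNgt int_iter_lt. Qed.

(** Applying the increasing map f^n to [t < f t] shows that each step along the orbit goes up. *)
Lemma orbit_homo : {homo (fun n => F n t) : m n / (m <= n) >-> (m <= n)%O}.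
Proof.
(* A nonnegative difference is a natural number [k], on which the induction runs. *)
move=> m n; rewrite -subr_ge0; case E: (n - m) => [k|//] _.
have -> : n = m + k%:Z by rewrite -E addrC subrK.
elim: k {E} => [|k IH]; first by rewrite addr0.
apply: (le_trans IH); rewrite int_iterD// int_iterD// int_iter_le.
by rewrite intS addrC int_iterD// int_iter_le ltW.
Qed.

(** By induction on n - m: either [s] is already below the previous orbit point, or that point
    starts the interval sought. *)
Lemma orbit_floor m n s :
  (F m t <= s)%O -> (s < F n t)%O ->
  exists k, (F k t <= s < F (k + 1) t)%O.
Proof.
move=> ms sn.
have : m < n.
  rewrite ltNge; apply/negP => /orbit_homo nm.
  by have := le_lt_trans (le_trans nm ms) sn; rewrite ltxx.
move=> /ltW; rewrite -subr_ge0; case E: (n - m) => [k|//] _.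
have {E} nE : n = m + k%:Z by rewrite -E addrC subrK.
rewrite {}nE in sn; elim: k sn => [|k IH].
  by rewrite addr0 ltNge ms.
have [//|ks] := ltP s (F (m + k%:Z) t) => [sk _|]; first exact: IH.
by rewrite intS addrCA addrC => sk; exists (m + k%:Z); rewrite ks.
Qed.

Let below := [set s | forall n, (s < F n t)%O].
Let above := [set s | forall n, (F n t <= s)%O].
Let middle := ~` (below `|` above).
Let period := [set s | (t <= s < f t)%O].

(** By totality, a point outside [below] and [above] has an orbit point at or under it and another
    strictly over it, so [orbit_floor] applies. *)
Lemma middleP s : middle s <-> exists k, (F k t <= s < F (k + 1) t)%O.
Proof.
rewrite /middle /= not_orE -!existsNE; split.
  by move=> [[m /negP]]; rewrite -leNgt => ms [n /negP]; rewrite -ltNge => sn;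
    apply: (orbit_floor ms sn).
move=> [k /andP[ks sk]]; split; [exists k|exists (k + 1)]; apply/negP.
  by rewrite -leNgt.
by rewrite -ltNge.
Qed.

Lemma period_shift k s : period s -> (F k t <= F k s < F (k + 1) t)%O.
Proof.
by move=> /andP[ts st]; rewrite int_iterD// int_iter_le int_iter_lt ts.
Qed.

(** The copy of [period] with index [k] is carried onto [f^k t, f^(k+1) t) by f^k. *)
Lemma middle_order_iso :
  order_iso (ordered_sum (fun _ : int => set_type period)) (set_type middle).
Proof.
have FM k (s : set_type period) : middle (F k (val s)).
  by apply/middleP; exists k; exact: period_shift (set_typeP s).
pose h k s : set_type middle := to_set_type (FM k s).
apply: (@ordered_sum_decomposition _ _ _ int (fun=> set_type period) _ h).
- by move=> k a b; rewrite -!Order.le_val /= int_iter_le.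
- move=> i j a b ij; rewrite -!lt_val /=.
  have /andP[_ ai] := period_shift i (set_typeP a).
  have /andP[jb _] := period_shift j (set_typeP b).
  (* Since [i < j] means [i + 1 <= j], interval [i] ends no later than interval [j] starts. *)
  apply: (lt_le_trans ai); apply: le_trans jb; apply: orbit_homo.
  by rewrite lezD1.
- move=> s; have [k /andP[ks sk]] := (middleP (val s)).1 (set_typeP s).
  have Fs : period (F (- k) (val s)).
    apply/andP; split.
      by rewrite -(int_iter_le k) int_iterNK.
    by rewrite -(int_iter_lt k) int_iterNK// -[f t]/(F 1 t) -int_iterD.
  by exists k, (to_set_type Fs); apply: val_inj; rewrite /= int_iterNK.
Qed.

Lemma automorphism_decomposition : exists A1 A2 A3 : set P,
  A2 !=set0 /\
  tp P = ot_add3 (tp (set_type A1))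
    (ot_mul (tp (set_type A2)) (tp int)) (tp (set_type A3)).
Proof.
exists below, period, above; split; first by exists t; rewrite /period /= lexx.
have /eq_tpP := middle_order_iso; rewrite -ot_mul_tp => ->.
pose A (i : 'I_3) : set P := match i : nat with
  | 0%N => below | 1%N => middle | _ => above end.
have := ot_add3_tp (fun i => set_type (A i)); rewrite /= /A !inordK// => ->.
apply/eq_tpP/order_iso_sym.
apply: (ordered_sum_decomposition (g := fun i (s : set_type (A i)) => val s)).
- by [].
- suff A_lt i j x y : (i < j)%O -> A i x -> A j y -> (x < y)%O.
    by move=> i j a b ij; apply: (A_lt i j _ _ ij); apply: set_typeP.
  case: i j => -[|[|[|//]]] ? [[|[|[|//]]] ?] //= _; rewrite /A /=.
  + by move=> xb /middleP[k /andP[+ _]]; apply: lt_le_trans.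
  + by move=> xb /(_ 0); apply: lt_le_trans.
  + by move=> /middleP[k /andP[_ xk]] /(_ (k + 1)); apply: lt_le_trans.
- suff As s : exists i, A i s.
    by move=> s; have [i Ais] := As s; exists i, (to_set_type Ais).
  have [sb|nb] := pselect (below s).
    by exists (inord 0); rewrite /A inordK.
  have [sa|na] := pselect (above s).
    by exists (inord 2); rewrite /A inordK.
  by exists (inord 1); rewrite /A inordK// => -[].
Qed.

End Orbit.

(** * From weak similarities to automorphisms of the distance set *)

Lemma weak_similarity_inj (R : realType) (X Y : semimetricSpace R)
    (Phi : X -> Y) : weak_similarity Phi -> injective Phi.
Proof.
move=> [_ [f [_ fE]]] x y xy; apply/dist_eq0.
(* Writing 0 as [dist y y] makes both sides values of [f] at distances that agree once
   [Phi x = Phi y]. *)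
have /dist_eq0 <- := erefl y.
by rewrite !fE xy.
Qed.

Lemma weak_similarity_automorphism (R : realType) (X : semimetricSpace R)
    (Phi : X -> X) : weak_similarity Phi -> ~ isometry Phi ->
  exists (f g : distance_set X -> distance_set X) t,
    [/\ cancel f g, cancel g f, {homo f : x y / (x < y)%O} & f t <> t].
Proof.
move=> wPhi nPhi; have Phi_inj := weak_similarity_inj wPhi.
have [Phi_surj [f [f_lt fE]]] := wPhi.
have DX (x y : X) : distance_set X (dist x y) by exists x, y.
pose F (r : distance_set X) := to_set_type (@funS _ _ _ _ f _ (set_typeP r)).
have F_lt : {homo F : x y / (x < y)%O}.
  by move=> x y; rewrite -!lt_val; apply: f_lt; apply: valP.
have FE (x y : X) : F (to_set_type (DX (Phi x) (Phi y))) = to_set_type (DX x y).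
  by apply: val_inj; rewrite /= -fE.
have F_surj r : exists s, F s = r.
  have [x [y rxy]] := set_typeP r; exists (to_set_type (DX (Phi x) (Phi y))).
  by rewrite FE; apply: val_inj.
have [G FG] := choice F_surj.
(* As [Phi] is bijective, it can fail to be an isometry only by changing some distance. *)
have [x [y xy]] : exists x y, dist (Phi x) (Phi y) <> dist x y.
  apply: contrapT => nxy; apply: nPhi; split; last first.
    by move=> x y; apply: contrapT => xy; apply: nxy; exists x, y.
  have [Psi PhiK] := choice Phi_surj.
  by exists Psi => // x; apply: Phi_inj.
(* The moved point is the distance of the images, which [F] sends to the different value
   [dist x y]. *)
exists F, G, (to_set_type (DX (Phi x) (Phi y))); split => //.
  by move=> r; apply: (inc_inj (le_mono F_lt)); rewrite FG.
by rewrite FE => /(congr1 val)/= xy'; apply: xy.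
Qed.

Theorem corollary3p17 (R : realType) (X : semimetricSpace R)
    (X_nonempty : inhabited X)
    (not_all_isometries :
       ~ (forall Phi : X -> X, weak_similarity Phi -> isometry Phi)) :
  exists A1 A2 A3 : set R,
    [/\ A1 `<=` distance_set X, A2 `<=` distance_set X,
        A3 `<=` distance_set X, A2 !=set0 &
        tp (distance_set X) =
          ot_add3 (tp A1) (ot_mul (tp A2) (tp int)) (tp A3)].
Proof.
have [Phi [wPhi nPhi]] : exists Phi : X -> X,
    weak_similarity Phi /\ ~ isometry Phi.
  apply: contrapT => nPhi; apply: not_all_isometries => Phi wPhi.
  by apply: contrapT => iPhi; apply: nPhi; exists Phi.
have [f [g [t [fK gK f_lt ft]]]] := weak_similarity_automorphism wPhi nPhi.
have g_lt := cancel_homo_lt gK f_lt.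
have [A1 [A2 [A3 [[a A2a] tpD]]]] : exists A1 A2 A3 : set (distance_set X),
    A2 !=set0 /\ tp (distance_set X) = ot_add3 (tp (set_type A1))
      (ot_mul (tp (set_type A2)) (tp int)) (tp (set_type A3)).
  have [tf|tf|tf] := ltgtP t (f t); last by case: ft.
    exact: automorphism_decomposition tf.
  (* If [f t < t], the inverse moves [t] up: t = g (f t) < g t. *)
  apply: (@automorphism_decomposition _ _ g f t) => //.
  by rewrite -{1}(fK t); apply: g_lt.
have imD (A : set (distance_set X)) : val @` A `<=` distance_set X.
  by move=> _ [x _ <-]; apply: set_typeP.
exists (val @` A1), (val @` A2), (val @` A3).
split => //; first by exists (val a), a.
have tp_im (A : set (distance_set X)) :
    tp (set_type (val @` A)) = tp (set_type A).
  exact/eq_tpP/order_iso_sym/image_val_order_iso.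
by rewrite !tp_im.
Qed.
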